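(* Let $k$ be a field of characteristic zero, $\mathfrak{g}$ a Lie algebra over $k$, $\mathfrak{u}$ a $\mathfrak{g}$-module, and $T\colon\mathfrak{u}\to\mathfrak{g}$ a linear map satisfying the classical Yang-Baxter equation \[ T\bigl(T(u).v-T(v).u\bigr)=[T(u),T(v)]\quad\text{for all }u,v\in\mathfrak{u}, \] and the condition \[ T(T(u).v).w=T(T(u).w).v\quad\text{for all }u,v,w\in\mathfrak{u}. \] Then the product $u\circ v=T(u).v$ defines a Novikov structure on the Lie algebra $\mathfrak{u}_T=(\mathfrak{u},[\,,\,]_T)$, where $[u,v]_T=T(u).v-T(v).u$.
   Context: The action of $x\in\mathfrak{g}$ on $u\in\mathfrak{u}$ is denoted $x.u$. A Novikov structure on a Lie algebra $\mathfrak{h}$ over $k$ is a $k$-bilinear product $(x,y)\mapsto x\cdot y$ on $\mathfrak{h}$ satisfying, for all $x,y,z\in\mathfrak{h}$: $x\cdot(y\cdot z)-(x\cdot y)\cdot z=y\cdot(x\cdot z)-(y\cdot x)\cdot z$ (left-symmetry), $(x\cdot y)\cdot z=(x\cdot z)\cdot y$, and $[x,y]=x\cdot y-y\cdot x$. *)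

(* Defs.v *)
From HB Require Import structures.
From mathcomp Require Import all_boot all_order all_algebra.

Set Implicit Arguments.
Unset Strict Implicit.
Unset Printing Implicit Defensive.

Import GRing.Theory.
Local Open Scope ring_scope.

(* A Lie algebra is a vector space, of arbitrary dimension, together with a
   bracket satisfying this predicate; the bracket is unbundled because the same
   space may carry several of them. *)
Record is_lie_bracket (k : fieldType) (h : lmodType k) (br : h -> h -> h)
    : Prop := IsLieBracket {
  lie_bilinear : bilinear_for *:%R *:%R br;
  lie_alternating : forall x, br x x = 0;
  lie_jacobi : forall x y z,
    br x (br y z) + br y (br z x) + br z (br x y) = 0
}.

Record is_lie_module (k : fieldType) (g u : lmodType k) (br : g -> g -> g)
    (act : g -> u -> u) : Prop := IsLieModule {
  lie_module_bilinear : bilinear_for *:%R *:%R act;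
  lie_module_bracket : forall x y v,
    act (br x y) v = act x (act y v) - act y (act x v)
}.

Record is_novikov_structure (k : fieldType) (h : lmodType k)
    (br : h -> h -> h) (mul : h -> h -> h) : Prop := IsNovikovStructure {
  novikov_bilinear : bilinear_for *:%R *:%R mul;
  novikov_left_symmetric : forall x y z,
    mul x (mul y z) - mul (mul x y) z = mul y (mul x z) - mul (mul y x) z;
  novikov_right_commutative : forall x y z,
    mul (mul x y) z = mul (mul x z) y;
  novikov_commutator : forall x y, br x y = mul x y - mul y x
}.

Definition T_product (k : fieldType) (g u : lmodType k) (act : g -> u -> u)
    (T : u -> g) (v w : u) : u :=
  act (T v) w.

Definition T_bracket (k : fieldType) (g u : lmodType k) (act : g -> u -> u)
    (T : u -> g) (v w : u) : u :=
  act (T v) w - act (T w) v.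

(* Main.v *)
Require Import Defs.
From HB Require Import structures.
From mathcomp Require Import all_boot all_order all_algebra.

Set Implicit Arguments.
Unset Strict Implicit.
Unset Printing Implicit Defensive.

Import GRing.Theory.
Local Open Scope ring_scope.

(** The classical Yang-Baxter equation says exactly that [T] carries the
    commutator of [v o w := T v . w] to the bracket of [g].  As [u] is a
    [g]-module, left multiplication therefore represents this commutator:
    [(v o w - w o v) o z = v o (w o z) - w o (v o z)].  This identity is left
    symmetry with its terms moved across the equation, and it also forces the
    Jacobi identity ([lie_bracket_commutator]), as for any left-symmetric
    product.  The second hypothesis on [T] is right commutativity of [o]. *)

(** Writing [L] for left multiplication, the hypothesis reads
    [L [x, y] = [L x, L y]].  Hence [[x, [y, z]] = x(yz) - x(zy) - y(zx) + z(yx)]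
    contains only right-nested products, and in the cyclic sum each of the six
    such products occurs once with each sign. *)
Lemma lie_bracket_commutator (k : fieldType) (h : lmodType k)
    (mul : h -> h -> h) (mul_bilin : bilinear_for *:%R *:%R mul)
    (mul_commutator : forall x y z,
       mul (mul x y - mul y x) z = mul x (mul y z) - mul y (mul x z)) :
  is_lie_bracket (fun x y => mul x y - mul y x).
Proof.
have [linl linr] := mul_bilin.
have mulBr x y z : mul x (y - z) = mul x y - mul x z.
  by rewrite [y - z]addrC -[- z]scaleN1r linr /= scaleN1r addrC.
split=> [|x|x y z].
- by split=> x a y z /=; rewrite [mul _ x]linl [mul x _]linr scalerBr opprD addrACA.
- exact: subrr.
rewrite !mulBr !mul_commutator.
(* Pairing terms as differences makes the cyclic sum telescope twice. *)
have pair (V : zmodType) (a b c d : V) : a - b - (c - d) = (a - c) + (d - b).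
  by rewrite opprB [d - c]addrC addrACA [- b + d]addrC.
by rewrite !pair [X in X + _]addrACA !subrKA addrACA !subrKA !subrr addr0.
Qed.

Theorem corollary3p4 (k : fieldType) (k_char0 : [pchar k] =i pred0)
    (g : lmodType k) (br : g -> g -> g) (br_lie : is_lie_bracket br)
    (u : lmodType k) (act : g -> u -> u) (act_mod : is_lie_module br act)
    (T : {linear u -> g})
    (T_cybe : forall v w : u,
       T (act (T v) w - act (T w) v) = br (T v) (T w))
    (T_comm : forall v w z : u,
       act (T (act (T v) w)) z = act (T (act (T v) z)) w) :
  is_lie_bracket (T_bracket act T) /\
  is_novikov_structure (T_bracket act T) (T_product act T).
Proof.
have [[linl linr] act_br] := act_mod.
have mul_bilin : bilinear_for *:%R *:%R (T_product act T).
  split=> [w a v v'|v]; last exact: linr.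
  by rewrite /T_product linearP; apply: linl.
have mul_commutator x y z :
    T_product act T (T_product act T x y - T_product act T y x) z =
    T_product act T x (T_product act T y z) -
    T_product act T y (T_product act T x z).
  by rewrite /T_product T_cybe act_br.
split; first exact: lie_bracket_commutator mul_bilin mul_commutator.
split=> // x y z.
have mulBl v w : T_product act T (v - w) z =
    T_product act T v z - T_product act T w z.
  by rewrite [v - w]addrC -[- w]scaleN1r mul_bilin.1 /= scaleN1r addrC.
move: (mul_commutator x y z); rewrite mulBl => E.
by apply/eqP; rewrite subr_eq addrAC -addrA E addrC subrK.
Qed.
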